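(* Let $X$ be a conditional set, $I$ a conditional set, and $(Y^i)_{i\in I}$ a conditional family in $S(X)$, i.e. a conditional function $I\to S(X)$, $i\mapsto Y^i$. Then there exists a conditional family $(y^i)_{i\in I}$ of conditional elements of $X$, i.e. a conditional function $I\to X$, $i\mapsto y^i$, such that $y^i\in Y^i$ for every $i\in I$.
   Context: $\mathcal{A}$ is a complete Boolean algebra with $0\neq1$; $p(a)$ is the set of families $(a_i)$ with $\bigvee a_i=a$, $a_i\wedge a_j=0$ for $i\ne j$. A conditional set on $\mathcal{A}$ is $X=(X_a,\gamma_a)_{a\in\mathcal{A}}$ with surjective maps $\gamma_a:X_1\to X_a$, $X_0$ a singleton, $\gamma_1=\mathrm{id}$, consistency ($a\le b$, $\gamma_b(x)=\gamma_b(y)\Rightarrow\gamma_a(x)=\gamma_a(y)$) and stability (for $(a_i)\in p(1)$, $x_i\in X_{a_i}$ there is a unique $x\in X_1$ with $\gamma_{a_i}(x)=x_i$, written $\sum a_ix_i$); $ax:=\gamma_a(x)$. A conditional subset of $X$ living on $b$ is determined by its primal set, a non-empty subset $Y_b\subseteq X_b$ stable under such gluings; its components are $Y_a=\{ay:y\in Y_b\}$ for $a\le b$. $S(X)$ is the collection of conditional subsets living on $1$; it is itself a conditional set with components $S(X)_a=\{Y_a: Y\in S(X)\}$ and maps $Y_1\mapsto Y_a$. A conditional element of $X$ written $x\in X$ is an element $x\in X_1$ (viewed as the conditional subset with primal set $\{x\}$); for $Y\in S(X)$, $y\in Y$ means $y\in Y_1$. A conditional function $f:Z\to W$ between conditional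 sets is a family of maps $f_a:Z_a\to W_a$ with $f_a(az)=af_1(z)$ for all $z\in Z_1$, $a\in\mathcal{A}$; a conditional family $(x_i)_{i\in I}$ in $W$ indexed by a conditional set $I$ is a conditional function $I\to W$, with $x_i:=f_1(i)$ for $i\in I_1$. *)

(* Defs.v *)
From mathcomp Require Import all_boot all_order.
From mathcomp Require Import boolp classical_sets.

Set Implicit Arguments.
Unset Strict Implicit.
Unset Printing Implicit Defensive.

Import Order.Theory.
Local Open Scope classical_set_scope.
Local Open Scope order_scope.

(* A complete Boolean algebra is a [ctbDistrLatticeType] satisfying
   [complete_lattice]. *)
Definition complete_lattice (d : Order.disp_t) (A : porderType d) : Prop :=
  forall S : set A, exists s : A, isLub S s.

(* Membership of the family [a_] in p(a). The index type is arbitrary and the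
   members [a_ j] may be zero, in particular repeatedly. *)
Definition partition_of (d : Order.disp_t) (A : ctbDistrLatticeType d)
    (J : Type) (a_ : J -> A) (a : A) : Prop :=
  isLub (range a_) a /\ forall i j : J, i <> j -> (a_ i `&` a_ j)%O = \bot.

Record condSet (d : Order.disp_t) (A : ctbDistrLatticeType d) := CondSet {
  comp :> A -> Type;
  res : forall a : A, comp \top -> comp a;
  res_surj : forall (a : A) (z : comp a), exists x : comp \top, res a x = z;
  comp_bot : exists x0 : comp \bot, forall x : comp \bot, x = x0;
  res_top : forall x : comp \top, res \top x = x;
  res_consistent : forall (a b : A) (x y : comp \top),
    a <= b -> res b x = res b y -> res a x = res a y;
  res_stable : forall (J : Type) (a_ : J -> A) (x_ : forall j, comp (a_ j)),
    partition_of a_ \top ->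
    exists! x : comp \top, forall j, res (a_ j) x = x_ j
}.

Arguments res {d A} X a x : rename.

(* A conditional subset living on 1. In [primal_stable] the element [x] is the
   gluing of the family [y_] along [a_]. *)
Record condSubset (d : Order.disp_t) (A : ctbDistrLatticeType d)
    (X : condSet A) := CondSubset {
  primal : set (X \top);
  primal_neq0 : exists x : X \top, primal x;
  primal_stable : forall (J : Type) (a_ : J -> A) (y_ : J -> X \top)
      (x : X \top),
    partition_of a_ \top -> (forall j, primal (y_ j)) ->
    (forall j, res X (a_ j) x = res X (a_ j) (y_ j)) -> primal x
}.

Definition subset_comp (d : Order.disp_t) (A : ctbDistrLatticeType d)
    (X : condSet A) (Y : condSubset X) (a : A) : set (X a) :=
  [set res X a y | y in primal Y].

Arguments subset_comp {d A X} Y a.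

Lemma subset_comp_top (d : Order.disp_t) (A : ctbDistrLatticeType d)
  (X : condSet A) (Y : condSubset X) : subset_comp Y \top = primal Y.
Proof.
apply/seteqP; split=> x; first by case=> y Yy <-; rewrite res_top.
by move=> Yx; exists x => //; rewrite res_top.
Qed.

Lemma res_local (d : Order.disp_t) (A : ctbDistrLatticeType d)
    (X : condSet A) (a : A) (J : Type) (b_ : J -> A) (x y : X \top) :
  partition_of b_ \top ->
  (forall j, res X (a `&` b_ j)%O x = res X (a `&` b_ j)%O y) ->
  res X a x = res X a y.
Proof.
move=> [[ub_b lub_b] dis_b] xy.
pose c_ (t : bool) : A := if t then a else ~` a.
have c_part : partition_of c_ \top.
  split; first split.
  - by move=> _ [t _ <-]; exact: lex1.
  - move=> u ub; rewrite -(joinxC a) leUx.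
    by rewrite (ub a) ?(ub (~` a)%O) //; [exists false | exists true].
  - by case=> [] [] //= _; rewrite ?meetxC // meetC meetxC.
have [w [w_c _]] := res_stable
  (fun t : bool => res X (c_ t) (if t then x else y)) c_part.
pose e_ (o : option J) : A := if o is Some j then (a `&` b_ j)%O else (~` a)%O.
have e_part : partition_of e_ \top.
  split; first split.
  - by move=> _ [t _ <-]; exact: lex1.
  - move=> u ub.
    have Ca : (~` a <= u)%O by apply: ub; exists None.
    have b_le : (\top <= u `|` ~` a)%O.
      apply: lub_b => _ [j _ <-].
      have -> : b_ j = ((a `&` b_ j) `|` (~` a `&` b_ j))%O.
        by rewrite -meetUl joinxC meet1x.
      apply: leU2; last exact: leIl.
      by apply: ub; exists (Some j).
    by apply: le_trans b_le _; rewrite leUx lexx.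
  - case=> [i|] [j|] //= ij.
    + by rewrite meetACA dis_b ?meetx0 // => eij; apply: ij; rewrite eij.
    + by rewrite meetAC meetxC meet0x.
    + by rewrite meetA [(~` a `&` a)%O]meetC meetxC meet0x.
have [v [_ v_uniq]] := res_stable (fun o => res X (e_ o) y) e_part.
have wy : w = y.
  rewrite -(v_uniq y) // -(v_uniq w) // => -[j|] /=; last exact: (w_c false).
  by rewrite -xy; apply: (res_consistent _ (w_c true)); exact: leIl.
by rewrite -wy (w_c true).
Qed.

Section Power.
Context (d : Order.disp_t) (A : ctbDistrLatticeType d) (X : condSet A).

Definition power_comp (a : A) : Type :=
  {Z : set (X a) | exists Y : condSubset X, Z = subset_comp Y a}.

Lemma power_res_subproof (a : A) (Z : power_comp \top) :
  exists Y : condSubset X, [set res X a y | y in sval Z] = subset_comp Y a.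
Proof. by case: Z => /= Z [Y ->]; exists Y; rewrite subset_comp_top. Qed.

Definition power_res (a : A) (Z : power_comp \top) : power_comp a :=
  exist _ [set res X a y | y in sval Z] (power_res_subproof a Z).

Arguments power_res a Z : clear implicits.

Lemma power_comp_inj (a : A) (Z W : power_comp a) : sval Z = sval W -> Z = W.
Proof. by case: Z W => [Z PZ] [W PW] /= ZW; apply: eq_exist. Qed.

Lemma power_surj (a : A) (Z : power_comp a) :
  exists W : power_comp \top, power_res a W = Z.
Proof.
case: Z => Z [Y YZ].
have PY : exists Y' : condSubset X, primal Y = subset_comp Y' \top.
  by exists Y; rewrite subset_comp_top.
by exists (exist _ (primal Y) PY); apply: power_comp_inj; rewrite /= YZ.
Qed.

Lemma power_top (Z : power_comp \top) : power_res \top Z = Z.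
Proof.
apply: power_comp_inj => /=; apply/seteqP; split=> x.
  by case=> y Zy <-; rewrite res_top.
by move=> Zx; exists x => //; rewrite res_top.
Qed.

Lemma power_consistent (a b : A) (Z W : power_comp \top) :
  a <= b -> power_res b Z = power_res b W -> power_res a Z = power_res a W.
Proof.
move=> ab /(congr1 sval) /= ZW; apply: power_comp_inj => /=.
have sub (P Q : set (X \top)) : [set res X b y | y in P] `<=`
    [set res X b y | y in Q] -> [set res X a y | y in P] `<=`
    [set res X a y | y in Q].
  move=> PQ _ [y Py <-].
  have [|z Qz zy] := PQ (res X b y); first by exists y.
  by exists z => //; apply: res_consistent zy.
by apply/seteqP; split; apply: sub; rewrite ZW.
Qed.

Lemma power_stable (J : Type) (a_ : J -> A)
    (Z_ : forall j, power_comp (a_ j)) :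
  partition_of a_ \top ->
  exists! Z : power_comp \top, forall j, power_res (a_ j) Z = Z_ j.
Proof.
move=> a_part.
have pick j : exists z, sval (Z_ j) z.
  case: (Z_ j) => /= Z [Y ->]; have [y Yy] := primal_neq0 Y.
  by exists (res X (a_ j) y); exists y.
pose P : set (X \top) := [set x | forall j, sval (Z_ j) (res X (a_ j) x)].
have P_ext j (z : X (a_ j)) : sval (Z_ j) z ->
    exists2 x, P x & res X (a_ j) x = z.
  move=> Zz.
  have Hex : forall k, exists wk : X (a_ k),
      sval (Z_ k) wk /\ forall e : j = k, wk = eq_rect j (fun k => X (a_ k)) z k e.
    move=> k; have [e|njk] := pselect (j = k).
      by case: k / e; exists z; split=> // e; rewrite (Prop_irrelevance e erefl).
    by have [wk Hwk] := pick k; exists wk.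
  pose w k := sval (cid (Hex k)).
  have Hw k := svalP (cid (Hex k)) : _ (w k).
  have [x [x_w _]] := res_stable w a_part.
  exists x; first by move=> k; rewrite x_w; case: (Hw k).
  by rewrite x_w; case: (Hw j) => _ /(_ erefl).
have P_neq0 : exists x, P x.
  pose w j := sval (cid (pick j)).
  have Hw j : sval (Z_ j) (w j) := svalP (cid (pick j)).
  have [x [x_w _]] := res_stable w a_part.
  by exists x => j; rewrite x_w.
have P_stable (K : Type) (b_ : K -> A) (y_ : K -> X \top) (x : X \top) :
    partition_of b_ \top -> (forall k, P (y_ k)) ->
    (forall k, res X (b_ k) x = res X (b_ k) (y_ k)) -> P x.
  move=> b_part Py xy j.
  case ZE: (Z_ j) => [Z [Y YZ]] /=.
  have /choice [u Hu] : forall k, exists u,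
      primal Y u /\ res X (a_ j) u = res X (a_ j) (y_ k).
    by move=> k; move: (Py k j); rewrite ZE /= YZ => -[u Yu uy]; exists u.
  have [v [v_u _]] := res_stable (fun k => res X (b_ k) (u k)) b_part.
  rewrite YZ; exists v.
    by apply: (primal_stable b_part (y_ := u)) => // k; case: (Hu k).
  apply: (res_local b_part) => k.
  transitivity (res X (a_ j `&` b_ k)%O (u k)).
    by apply: (res_consistent _ (v_u k)); exact: leIr.
  transitivity (res X (a_ j `&` b_ k)%O (y_ k)).
    by case: (Hu k) => _; apply: res_consistent; exact: leIl.
  by apply/esym/(res_consistent _ (xy k)); exact: leIr.
have PY : exists Y : condSubset X, P = subset_comp Y \top.
  by exists (CondSubset P_neq0 P_stable); rewrite subset_comp_top.
exists (exist _ P PY); split.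
  move=> j; apply: power_comp_inj => /=; apply/seteqP; split=> z.
    by case=> x Px <-.
  by case/P_ext=> x Px <-; exists x.
move=> [W [Y WY]] ZW; apply: power_comp_inj => /=.
have WP : W = primal Y by rewrite WY subset_comp_top.
have res_W j : [set res X (a_ j) y | y in W] = sval (Z_ j) by rewrite -ZW.
apply/seteqP; split=> x.
  move=> Px; have /choice [u Hu] : forall j, exists u,
      primal Y u /\ res X (a_ j) u = res X (a_ j) x.
    by move=> j; move: (Px j); rewrite -res_W WP => -[u Yu ux]; exists u.
  rewrite WP; apply: (primal_stable a_part (y_ := u)).
    by move=> j; case: (Hu j).
  by move=> j; case: (Hu j).
by move=> Wx j; rewrite -res_W; exists x.
Qed.

Lemma power_bot :
  exists Z0 : power_comp \bot, forall Z : power_comp \bot, Z = Z0.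
Proof.
have [x0 x0_uniq] := comp_bot X.
have [x _] := res_surj x0.
have PY : exists Y : condSubset X, (setT : set (X \bot)) = subset_comp Y \bot.
  have Tn : exists x : X \top, (setT : set (X \top)) x by exists x.
  exists (@CondSubset _ _ X setT Tn (fun _ _ _ _ _ _ _ => I)).
  by apply/seteqP; split=> // y _; exists x => //; rewrite (x0_uniq y).
exists (exist _ setT PY) => -[Z [Y YZ]]; apply: power_comp_inj.
rewrite /= YZ; apply/seteqP; split=> // y _; have [z Yz] := primal_neq0 Y.
by exists z => //; rewrite (x0_uniq y) (x0_uniq (res X \bot z)).
Qed.

(* The conditional set S(X). An element of [condPower \top] is a set of
   elements of [X \top], namely the primal set of a conditional subset. *)
Definition condPower : condSet A :=
  CondSet power_surj power_bot power_top power_consistent power_stable.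

End Power.

Definition cond_mem (d : Order.disp_t) (A : ctbDistrLatticeType d)
    (X : condSet A) (y : X \top) (Y : condPower X \top) : Prop := sval Y y.

Record condFun (d : Order.disp_t) (A : ctbDistrLatticeType d)
    (Z W : condSet A) := CondFun {
  fun_comp :> forall a : A, Z a -> W a;
  fun_res : forall (z : Z \top) (a : A),
    fun_comp (res Z a z) = res W a (fun_comp z)
}.

Arguments fun_comp {d A Z W} f a z : rename.

(* Main.v *)
Require Import Defs.
From mathcomp Require Import all_boot all_order.
From mathcomp Require Import boolp classical_sets.
From mathcomp Require wochoice.

(* Well-order [I \top] and choose, for each k, an element y_k of Y^k. For i and
   k let b_ik be the largest condition on which i and k agree, and let c_ik be
   b_ik minus the join of the b_il with l < k. Since b_ii = 1, the c_ik
   partition 1, and y^i is the gluing of the y_k along them. On c_ik the sets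
   Y^i and Y^k agree, so y^i lies in Y^i; and if i and j agree on a, then so do
   c_ik and c_jk for all k, hence also y^i and y^j. *)

Import Order.Theory.
Local Open Scope classical_set_scope.
Local Open Scope order_scope.

(** The strict part of the boolean well-order that Zermelo's theorem gives on [{classic T}]. *)
Lemma exists_well_order (T : Type) : exists lt : T -> T -> Prop,
  (forall x y, x <> y -> lt x y \/ lt y x) /\
  (forall P : set T, P !=set0 -> exists2 x, P x & forall y, lt y x -> ~ P y).
Proof.
have [R R_wo] := wochoice.well_ordering_principle {classic T}.
have R_wo_in : wochoice.wo_chain R predT by move=> P _; exact: R_wo.
have R_total := wochoice.wo_chainW R_wo_in.
have R_anti := wochoice.wo_chain_antisymmetric R_wo_in.
exists (fun x y => x <> y /\ R x y); split=> [x y xy|P [x Px]].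
  have /orP[Rxy|Ryx] := R_total x y isT isT; [by left | right].
  by split=> // yx; apply: xy.
have [|m [[/asboolP Pm m_min] _]] := R_wo (fun z => `[< P z >]).
  by exists x; apply/asboolP.
exists m => // y [ym Rym] Py; apply: ym.
apply: R_anti => //; rewrite Rym /=.
by apply: m_min; apply/asboolP.
Qed.

Section Disjointification.
Set Implicit Arguments.
Unset Strict Implicit.
Context (d : Order.disp_t) (A : ctbDistrLatticeType d).
Context (sup : set A -> A) (supP : forall S, isLub S (sup S)).
Context (J : Type) (lt : J -> J -> Prop).
Context (lt_total : forall x y, x <> y -> lt x y \/ lt y x).
Context (lt_wf : forall P : set J,
  P !=set0 -> exists2 x, P x & forall y, lt y x -> ~ P y).

Definition disjointify (b_ : J -> A) j : A :=
  b_ j `\` sup [set b_ k | k in lt ^~ j].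

Lemma disjointify_le (b_ : J -> A) j : disjointify b_ j <= b_ j.
Proof. exact: leBx. Qed.

Lemma disjointify_meet (b_ : J -> A) i j :
  i <> j -> disjointify b_ i `&` disjointify b_ j = \bot.
Proof.
have dis k l : lt k l -> disjointify b_ k `&` disjointify b_ l = \bot.
  move=> kl; apply/eqP; rewrite -lex0.
  set s := sup [set b_ m | m in lt ^~ l].
  have bs : b_ k <= s by apply: (supP _).1; exists k.
  by rewrite -(meetxC s) leI2 ?leBC // (le_trans (disjointify_le _ _)).
by move=> /lt_total[/dis//|/dis]; rewrite meetC.
Qed.

(** If [u] bounds all the pieces but not every [b_ j], take the least [m] with [b_ m] not below [u].
    The join [s] of the earlier terms is then below [u], and [b_ m] lies below the join of its piece
    and [s], a contradiction. *)
Lemma disjointify_partition (b_ : J -> A) (a : A) :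
  isLub (range b_) a -> partition_of (disjointify b_) a.
Proof.
move=> [b_a a_min]; split; last exact: disjointify_meet.
split=> [_ [j _ <-]|u c_u].
  by rewrite (le_trans (disjointify_le _ _)) // b_a //; exists j.
apply: a_min => _ [j _ <-]; apply: contrapT => nbu.
have [|m nmu m_min] := @lt_wf (fun k => ~ (b_ k <= u)); first by exists j.
apply: nmu; set s := sup [set b_ k | k in lt ^~ m].
have su : s <= u.
  apply: (supP _).2 => _ [k km <-]; apply: contrapT; exact: m_min.
have cu : disjointify b_ m <= u by apply: c_u; exists m.
rewrite (le_trans (leUl _ s)) // -diffUK leUx su andbT.
exact: cu.
Qed.

(** Meeting with [a] commutes with arbitrary joins, so below [a] both families have the same joins
    of earlier terms to subtract. *)
Lemma disjointify_local (b_ b'_ : J -> A) (a : A) j :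
  (forall k, a `&` b_ k <= b'_ k) -> (forall k, a `&` b'_ k <= b_ k) ->
  a `&` disjointify b_ j <= disjointify b'_ j.
Proof.
move=> bb' b'b; rewrite {2}/disjointify leBRL; apply/andP; split.
  by rewrite (le_trans _ (bb' j)) // leI2 // disjointify_le.
set s' := sup _; set s := sup [set b_ k | k in lt ^~ j].
have as' : a `&` s' <= s.
  (* Moving [a] to the right as a complement leaves a bound on [s'] alone, which is checked term by
     term. *)
  rewrite meetC -(complK a) -diffE leBLR; apply: (supP _).2 => _ [k kj <-].
  rewrite -leBLR diffE complK meetC (le_trans (b'b k)) //.
  by apply: (supP _).1; exists k.
by rewrite meetAC -lex0 -(meetxC s) leI2 ?leBC.
Qed.

End Disjointification.

Section CondSet.
Set Implicit Arguments.
Unset Strict Implicit.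
Context (d : Order.disp_t) (A : ctbDistrLatticeType d).
Context (sup : set A -> A) (supP : forall S, isLub S (sup S)).
Implicit Types X Z W : condSet A.

(** Completes a partition of [a] to one of [\top], as [res_local] requires. *)
Lemma partition_option (J : Type) (a_ : J -> A) (a : A) :
  partition_of a_ a ->
  partition_of (fun o => if o is Some j then a_ j else ~` a) \top.
Proof.
move=> [[a_a a_min] a_dis].
have dis j : a_ j `&` ~` a = \bot.
  by apply/eqP; rewrite -lex0 -(meetxC a) leI2 // a_a //; exists j.
split; first split.
- by move=> _ [o _ <-]; exact: lex1.
- move=> u ub; rewrite -(joinxC a) leUx (ub (~` a)) ?andbT; last by exists None.
  by apply: a_min => _ [j _ <-]; apply: ub; exists (Some j).
- case=> [i|] [j|] //= ij; last by rewrite meetC.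
  by apply: a_dis => eij; apply: ij; rewrite eij.
Qed.

(** Disjointifying [S] along a well-order gives a partition of [s] into pieces on which [x] and [y]
    agree. Hence a largest condition of agreement exists. *)
Lemma res_lub X (S : set A) (s : A) (x y : X \top) :
  isLub S s -> (forall b, S b -> res X b x = res X b y) ->
  res X s x = res X s y.
Proof.
move=> S_s xy.
have [lt [lt_total lt_wf]] := exists_well_order {b | S b}.
have S_range : isLub (range (fun b : {b | S b} => sval b)) s.
  suff -> : range (fun b : {b | S b} => sval b) = S by [].
  apply/seteqP; split=> [_ [[b Sb] _ <-] //|b Sb].
  by exists (exist _ b Sb).
have := disjointify_partition supP lt_total lt_wf S_range.
move=> /partition_option/res_local; apply=> -[[b Sb]|].
  apply: (res_consistent _ (xy b Sb)).
  exact: le_trans (leIr _ _) (disjointify_le _ _ _ _).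
(* The added piece, the complement of [s], meets [s] in [\bot], where [X] has a single element. *)
rewrite meetxC; have [x0 x0P] := comp_bot X.
by rewrite (x0P (res X _ x)) (x0P (res X _ y)).
Qed.

(** The component at [a] lifts to [Z \top], applies [g] and restricts; the hypothesis makes the
    choice of lift immaterial. *)
Lemma extend_condFun Z W (g : Z \top -> W \top) :
  (forall a x y, res Z a x = res Z a y -> res W a (g x) = res W a (g y)) ->
  exists f : condFun Z W, forall z, f \top z = g z.
Proof.
move=> g_res; pose lift a (z : Z a) := sval (cid (res_surj z)).
have liftP a z : res Z a (lift a z) = z := svalP (cid (res_surj z)).
have f_top z : res W \top (g (lift \top z)) = g z.
  by rewrite res_top -[in RHS](liftP _ z) res_top.
have f_res (z : Z \top) a :
    res W a (g (lift a (res Z a z))) = res W a (res W \top (g (lift \top z))).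
  by rewrite f_top; apply: g_res; rewrite liftP.
by exists (CondFun (fun_comp := fun a z => res W a (g (lift a z))) f_res).
Qed.

Lemma power_primal X (Z : condPower X \top) :
  exists V : condSubset X, sval Z = primal V.
Proof.
by case: Z => Z [V ZV]; exists V; rewrite /= ZV subset_comp_top.
Qed.

End CondSet.

Theorem theorem2p17 (d : Order.disp_t) (A : ctbDistrLatticeType d)
    (A_complete : complete_lattice A) (A_nontrivial : (\bot : A) <> \top)
    (X I : condSet A) (Y : condFun I (condPower X)) :
  exists y : condFun I X,
    forall i : I \top, cond_mem (y \top i) (Y \top i).
Proof.
have [sup supP] := choice A_complete.
have [lt [lt_total lt_wf]] := exists_well_order (I \top).
have /choice[y yY] : forall k, exists x, cond_mem x (Y \top k).
  move=> k; rewrite /cond_mem; have [V ->] := power_primal (Y \top k).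
  exact: primal_neq0.
pose b i k := sup [set a | res I a i = res I a k].
have le_b a i k : res I a i = res I a k -> a <= b i k.
  by move=> ik; apply: (supP _).1.
have res_b i k : res I (b i k) i = res I (b i k) k.
  exact: (res_lub supP (supP _)).
pose c i := disjointify sup lt (b i).
have c_part i : partition_of (c i) \top.
  apply: (disjointify_partition supP lt_total lt_wf).
  split=> [? _|u ub]; first exact: lex1.
  by apply: (@le_trans _ _ (b i i)); [exact: le_b | apply: ub; exists i].
have res_c i k : res I (c i k) i = res I (c i k) k.
  exact: (res_consistent (disjointify_le _ _ _ _) (res_b i k)).
have /choice[g g_c] : forall i, exists x,
    forall k, res X (c i k) x = res X (c i k) (y k).
  move=> i; pose y_ k := res X (c i k) (y k).
  by have [x [xP _]] := res_stable y_ (c_part i); exists x.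
have [|f fg] := @extend_condFun _ _ I X g.
  move=> a i j ij; apply: (res_local (c_part i)) => k.
  have c_local : a `&` c i k <= c j k.
    (* On [a] meet [b i1 l], [j1] agrees with [i1] and [i1] with [l]. This is needed for (i, j) and
       for (j, i). *)
    have b_local i1 j1 : res I a i1 = res I a j1 ->
        forall l, a `&` b i1 l <= b j1 l.
      move=> e l; apply: le_b.
      rewrite -(res_consistent _ e) ?leIl //.
      by apply: (res_consistent _ (res_b i1 l)); rewrite leIr.
    apply: (disjointify_local supP); exact: b_local.
  transitivity (res X (a `&` c i k) (y k)).
    by apply: (res_consistent _ (g_c i k)); rewrite leIr.
  by apply/esym; apply: (res_consistent c_local (g_c j k)).
exists f => i; rewrite fg.
(* On [c i k], where [i] and [k] agree, [Y] gives both the same restriction, so [y k] agrees there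
   with some element of [Y \top i]. Stability then puts the gluing [g i] in [Y \top i]. *)
have /choice[u uP] : forall k, exists x,
    cond_mem x (Y \top i) /\ res X (c i k) x = res X (c i k) (y k).
  move=> k.
  have : sval (res (condPower X) (c i k) (Y \top i)) (res X (c i k) (y k)).
    by rewrite -fun_res res_c fun_res /=; exists (y k) => //; exact: yY.
  by case=> x Yx xy; exists x.
move: uP; rewrite /cond_mem; have [V ->] := power_primal (Y \top i) => uP.
apply: (primal_stable (c_part i) (y_ := u)) => k; first by case: (uP k).
by rewrite g_c; case: (uP k).
Qed.
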